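(* Let $\mathbb{A}=\{a_n : n\in\mathbb{N}\}\subseteq\mathbb{R}$ be a real sequence belonging to the class (A), i.e. $a_0=0$, $a_{n+1}-a_n\ge 1$ for every $n\in\mathbb{N}$, and $\log a_n=o(n)$ as $n\to\infty$. Then for each $0\le p<1$ there exists a Lebesgue measurable set $E\subseteq\mathbb{R}$ such that $$|E\cap[m,m+1]|\ge p\quad\text{for all } m\in\mathbb{Z},$$ but $E$ does not contain any affine copy of $\mathbb{A}$; that is, for all $x\in\mathbb{R}$ and all $t>0$ the set $x+t\mathbb{A}=\{x+ta_n: n\in\mathbb{N}\}$ is not contained in $E$.
   Context: $\mathbb{N}=\{0,1,2,\dots\}$ and $|\cdot|$ denotes Lebesgue measure on $\mathbb{R}$. An affine copy of $\mathbb{A}$ is a set $x+t\mathbb{A}$ with $x\in\mathbb{R}$, $t>0$. A real sequence $(a_n)_{n\in\mathbb{N}}$ is in the class (A) if (1) $a_0=0$, (2) $a_{n+1}-a_n\ge1$ for every $n\in\mathbb{N}$, and (3) $\log a_n=o(n)$, i.e. $\frac{\log a_n}{n}\to0$ as $n\to\infty$. *)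

(* Defs.v *)
From HB Require Import structures.
From mathcomp Require Import all_boot all_order all_algebra.
From mathcomp Require Import all_classical all_reals all_analysis.

Set Implicit Arguments.
Unset Strict Implicit.
Unset Printing Implicit Defensive.

Import Order.TTheory GRing.Theory Num.Theory.
Import numFieldNormedType.Exports.

Local Open Scope classical_set_scope.
Local Open Scope ring_scope.

(* At n = 0 the quotient is the junk value ln 0 / 0, which does not affect the
   limit; for n >= 1 the gap condition gives a n >= 1. *)
Definition class_A (R : realType) (a : nat -> R) : Prop :=
  [/\ a 0%N = 0,
      forall n : nat, 1 <= a n.+1 - a n
    & (fun n : nat => ln (a n) / n%:R) @ \oo --> (0 : R)].

Definition affine_copy (R : realType) (x t : R) (A : set R) : set R :=
  [set x + t * y | y in A].

(* The sigma-algebra on which completed_lebesgue_measure is a measure; by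
   completed_caratheodory_measurable it is the completion of the Borel
   sigma-algebra, whereas measurable at type R means Borel measurable. *)
Definition lebesgue_measurable (R : realType) (E : set R) : Prop :=
  ((wlength (@idfun R))^*%mu).-cara.-measurable E.

(* Main.v *)
Require Import Defs.
From mathcomp Require Import all_boot all_order all_algebra.
From mathcomp Require Import all_classical all_reals all_analysis.
From mathcomp Require Import ring lra zify.

Import Order.TTheory GRing.Theory Num.Theory.
Import numFieldNormedType.Exports.

Local Open Scope classical_set_scope.
Local Open Scope ring_scope.

(* Each unit interval [m, m+1) is cut into J equal cells, and the complement F
   of E consists of one chosen cell per unit interval, enlarged to length 2/J;
   so E has density at least 1 - 6/J >= p in every [m, m+1].  It remains to
   choose the cells so that every x + tA meets F.  Fix K and let |x| <= K,
   1/K <= t <= K.  Taking every K-th term of A makes the points x + t a_n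
   1-separated, so N of them fall into distinct unit intervals and a random
   choice of cells misses all of them with probability (1 - 1/J)^N.  Thanks to
   the enlargement it suffices to treat (x, t) in a grid of O(a_{s+KN}) points,
   and since log a_n = o(n) the union bound succeeds for N large.  Far-out
   windows of terms of A give disjoint finite blocks of unit intervals for
   K = 1, 2, 3, ..., and the choices made on the blocks are glued together. *)

(** * Counting choices of cells *)

Lemma card_avoiding (M N j : nat) (m : 'I_N -> 'I_M) (c : 'I_N -> 'I_j.+1) :
  injective m ->
  #|[set f : {ffun 'I_M -> 'I_j.+1} | [forall n, f (m n) != c n]]%SET|
    = (j ^ N * j.+1 ^ (M - N))%N.
Proof.
move=> m_inj.
pose F k : pred 'I_j.+1 := [pred v | [forall n, (m n == k) ==> (v != c n)]].
have -> : #|[set f : {ffun 'I_M -> 'I_j.+1} | [forall n, f (m n) != c n]]%SET|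
        = #|(family F : simpl_pred {ffun 'I_M -> 'I_j.+1})|.
  apply: eq_card => f; rewrite inE; apply/forallP/familyP => [fc k|fF n].
    by rewrite inE; apply/forallP => n; apply/implyP => /eqP <-.
  by have := fF (m n); rewrite inE => /forallP/(_ n); rewrite eqxx.
rewrite card_family.
have -> (s : seq 'I_M) : foldr muln 1%N [seq #|F k| | k <- s]
                         = (\prod_(k <- s) #|F k|)%N.
  by elim: s => [|k s IH]; rewrite ?big_nil ?big_cons //= IH.
pose D : {set 'I_M} := [set m n | n : 'I_N]%SET.
have cardD : #|D| = N by rewrite card_imset ?card_ord.
rewrite big_enum /= (bigID (mem D)) /=; congr (_ * _)%N.
  rewrite (eq_bigr (fun=> j)) => [|_ /imsetP[n _ ->]].
    by rewrite prod_nat_const cardD.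
  have -> : #|F (m n)| = #|predC1 (c n)|.
    apply: eq_card => v; rewrite !inE; apply/forallP/idP => [/(_ n)|vc n'].
      by rewrite eqxx.
    by apply/implyP => /eqP/m_inj ->.
  by rewrite cardC1 card_ord.
rewrite (eq_bigr (fun=> j.+1)) => [|k kD].
  rewrite prod_nat_const; congr (_ ^ _)%N.
  have -> : #|(fun i => i \notin D)| = #|~: D|%SET.
    by apply: eq_card => k; rewrite !inE.
  by rewrite cardsCs finset.setCK cardD card_ord.
rewrite -[RHS]card_ord; apply: eq_card => v; rewrite !inE.
apply/forallP => n; apply/implyP => /eqP mnk.
by move: kD; rewrite -mnk imset_f.
Qed.

(** Union bound: each [g] is missed by a proportion [(j / j.+1) ^ N] of the functions on a large
    enough ['I_M], so some function is missed by no [g]. *)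
Lemma hitting_function (G : finType) (N j : nat)
    (m : G -> 'I_N -> nat) (c : G -> 'I_N -> 'I_j.+1) :
  (forall g, injective (m g)) -> (#|G| * j ^ N < j.+1 ^ N)%N ->
  exists f : nat -> 'I_j.+1, forall g, exists n, f (m g n) = c g n.
Proof.
move=> m_inj GN.
pose M := (\max_g \max_n m g n).+1.
have mM g n : (m g n < M)%N.
  by rewrite ltnS (leq_trans (leq_bigmax n)) // (leq_bigmax g).
pose m' g n : 'I_M := Ordinal (mM g n).
have m'_inj g : injective (m' g) by move=> n n' [] /m_inj.
pose bad g := [set f : {ffun 'I_M -> 'I_j.+1} | [forall n, f (m' g n) != c g n]]%SET.
have [[f fgood]|nogood] :=
    pselect (exists f : {ffun 'I_M -> 'I_j.+1}, forall g, f \notin bad g).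
  exists (fun k => f (inord k)) => g.
  have := fgood g; rewrite inE negb_forall => /existsP[n].
  rewrite negbK => /eqP fc; exists n; rewrite -fc; congr (f _).
  by apply: val_inj; rewrite /= inordK.
(* The bound [N <= M] below comes from an injection [m' g0], so an empty [G] is treated apart. *)
have [g0|] := pickP G; last first.
  move=> G0; exfalso; apply: nogood; exists [ffun=> ord0] => g.
  by have := G0 g.
have NM : (N <= M)%N.
  by have := leq_card _ (m'_inj g0); rewrite !card_ord.
have : (#|{ffun 'I_M -> 'I_j.+1}| <= \sum_g #|bad g|)%N.
  under eq_bigr do rewrite -sum1_card big_mkcond /=.
  rewrite exchange_big /= -sum1_card; apply: leq_sum => f _.
  have [g fg] : exists g, f \in bad g.
    apply: contra_notP nogood => nobad; exists f => g.
    by apply/negP => fg; apply: nobad; exists g.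
  by rewrite (bigD1 g) //= fg.
under eq_bigr do rewrite card_avoiding //.
rewrite sum_nat_const card_ffun !card_ord -{1}(subnKC NM) expnD mulnA.
by rewrite leq_pmul2r ?expn_gt0// leqNgt GN.
Qed.

(** * Growth of sequences in the class (A) *)

Lemma class_A_gap (R : realType) (a : nat -> R) (n k : nat) :
  class_A a -> a n + k%:R <= a (n + k)%N.
Proof.
case=> _ gap _; elim: k => [|k IH]; first by rewrite addn0 addr0.
by have := gap (n + k)%N; rewrite addnS -natr1; lra.
Qed.

Lemma class_A_ge (R : realType) (a : nat -> R) (n : nat) :
  class_A a -> n%:R <= a n.
Proof.
by move=> aA; have := class_A_gap _ _ 0 n aA; case: aA => -> _ _; rewrite add0r.
Qed.

(** Subexponential growth survives the linear reindexing [s + K * N], so the ratio [(j.+1 / j) ^ N]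
    wins. The left side is the count for the union bound. *)
Lemma class_A_growth (R : realType) (a : nat -> R) (s K j : nat) (C : R) :
  class_A a -> (0 < K)%N ->
  exists N, C * (a (s + K * N)%N + 1) * j%:R ^+ N < j.+1%:R ^+ N.
Proof.
move=> aA K0; wlog C0 : C / 0 < C => [wlg|].
  have [N HN] := wlg (`|C| + 1) ltac:(by rewrite ltr_wpDl).
  exists N; apply: le_lt_trans HN; rewrite ler_wpM2r ?exprn_ge0//.
  rewrite ler_wpM2r ?addr_ge0// ?(le_trans _ (class_A_ge _ _ _ aA))//.
  by rewrite (le_trans (ler_norm C))// lerDl.
have J0 : (0 : R) < j.+1%:R by rewrite ltr0n.
have KR : (0 : R) < K%:R by rewrite ltr0n.
(* With this rate, [d * K * N] is [N / (2 * j.+1)], so [a (s + K * N) <= e * h] while [h * h] is at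
   most [(j.+1 / j) ^ N]. One factor [h] absorbs [a], the other the constant [2 * C * e]. *)
pose d : R := (2 * K%:R * j.+1%:R)^-1.
have d0 : 0 < d by rewrite invr_gt0 !mulr_gt0.
have [n0 _ Hn0] : \forall n \near \oo, a n <= expR (d * n%:R).
  have [_ _ /cvgrPdist_lt/(_ _ d0)] := aA.
  apply: filter_app; near=> n; rewrite sub0r normrN => lnd.
  have n0 : (0 : R) < n%:R by rewrite ltr0n; near: n; exact: nbhs_infty_gt.
  have an0 : 0 < a n := lt_le_trans n0 (class_A_ge _ _ n aA).
  rewrite -[a n]lnK ?posrE// ler_expR -ler_pdivrMr//.
  by rewrite ltW// (le_lt_trans (ler_norm _)).
pose B : R := 4 * C * expR (d * s%:R) * j.+1%:R.
have B0 : 0 <= B by rewrite !mulr_ge0 ?expR_ge0// ltW.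
pose N := (n0 + (Num.truncn B).+1)%N; exists N.
have BN : B < N%:R.
  by rewrite (lt_le_trans (truncnS_gt B))// ler_nat leq_addl.
set e := expR (d * s%:R) in B B0 N BN *.
have e0 : 1 <= e by rewrite -expR0 ler_expR mulr_ge0// ltW.
pose h := expR (N%:R / (2 * j.+1%:R)) : R.
have h1 : 1 <= h by rewrite -expR0 ler_expR divr_ge0.
have hB : 2 * C * e < h.
  apply: lt_le_trans (expR_ge1Dx _).
  have : 2 * C * e < N%:R / (2 * j.+1%:R).
    by rewrite ltr_pdivlMr ?mulr_gt0//; move: BN; rewrite /B; lra.
  by move=> /lt_le_trans; apply; rewrite lerDr.
have aN : a (s + K * N)%N <= e * h.
  have /Hn0/le_trans -> // : (n0 <= s + K * N)%N.
    by rewrite (leq_trans _ (leq_addl _ _))// (leq_trans _ (leq_pmull _ K0))// leq_addr.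
  rewrite -expRD ler_expR natrD natrM mulrDr lerD2l /d.
  by rewrite le_eqVlt; apply/orP; left; apply/eqP; field; rewrite !lt0r_neq0.
have jN : j%:R ^+ N * (h * h) <= j.+1%:R ^+ N :> R.
  have -> : h * h = expR (j.+1%:R^-1) ^+ N.
    rewrite -expRD -expRM_natr; congr expR.
    by field; rewrite lt0r_neq0.
  rewrite -exprMn lerXn2r ?nnegrE ?mulr_ge0 ?expR_ge0//.
  (* The inequality [1 - 1/j.+1 <= exp (- 1/j.+1)], multiplied by [j.+1]. *)
  have := expR_ge1Dx (- j.+1%:R^-1 : R); rewrite expRN => h2.
  rewrite -ler_pdivlMr ?expR_gt0//.
  apply: (le_trans _ (ler_wpM2l (ltW J0) h2)).
  by rewrite mulrDr mulrN divff ?lt0r_neq0// -natr1; lra.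
have jN0 : (0 : R) <= j%:R ^+ N by rewrite exprn_ge0.
have h0 : 0 < h by lra.
have eh1 : 1 <= e * h by rewrite mulr_ege1.
have Ceh : C * (a (s + K * N)%N + 1) <= 2 * C * e * h.
  have -> : 2 * C * e * h = C * (2 * (e * h)) by ring.
  by rewrite ler_pM2l//; lra.
have [jN00|jN1] := eqVneq (j%:R ^+ N : R) 0.
  by rewrite jN00 mulr0 exprn_gt0.
have jN_gt0 : (0 : R) < j%:R ^+ N by rewrite lt_neqAle eq_sym jN1.
apply: lt_le_trans jN; rewrite [ltLHS]mulrC ltr_pM2l//.
by apply: le_lt_trans Ceh _; rewrite ltr_pM2r.
Unshelve. all: by end_near. Qed.

Lemma floor_grid (R : realType) (h y : R) (n : nat) :
  0 < h -> 0 <= y -> y <= h * n%:R ->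
  exists i : 'I_n.+1, h * i%:R <= y < h * i%:R + h.
Proof.
move=> h0 y0 yn.
have yh0 : 0 <= y / h by rewrite divr_ge0// ltW.
have in1 : (Num.truncn (y / h) < n.+1)%N.
  by rewrite truncn_lt_nat// ltr_pdivrMr// -natr1; lra.
exists (Ordinal in1) => /=; have := truncn_itv yh0.
by rewrite ler_pdivlMr// ltr_pdivrMr// -natr1 => /andP[? ?]; apply/andP; split; lra.
Qed.

(** * One block of cells for a compact range of [(x, t)] *)

Lemma hit_compact (R : realType) (a : nat -> R) (j K L : nat) :
  class_A a -> (0 < K)%N ->
  exists Mf : nat * (nat -> 'I_j.+1), (L <= Mf.1)%N /\
  forall x t : R, `|x| <= K%:R -> K%:R^-1 <= t -> t <= K%:R ->
  exists n m, (L <= m < Mf.1)%N /\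
    (m * j.+1 + Mf.2 m)%:R <= j.+1%:R * (x + t * a n)
                        <= (m * j.+1 + Mf.2 m)%:R + 2.
Proof.
move=> aA K0; pose J := j.+1.
have KR : (1 : R) <= K%:R by rewrite ler1n.
have KV0 : (0 : R) < K%:R^-1 by rewrite invr_gt0 ltr0n.
have JR : (0 : R) < J%:R by rewrite ltr0n.
(* From index [s] on, [t * a n >= L + K] as [t >= 1/K], so [x >= -K] leaves the points beyond
   [L]. *)
pose s := (K * (L + K))%N.
(* Chosen so that the grid [G] has at most [C * A] points, with [A <= b + 1]. *)
pose C := ((4 * K * J).+1 * (2 * J * K).+1)%N.
have [N HN] := class_A_growth _ _ s K j C%:R aA K0.
set b := a (s + K * N)%N in HN.
have b0 : 0 <= b by rewrite (le_trans _ (class_A_ge _ _ _ aA)).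
pose A := (Num.truncn b).+1.
have AR : (0 : R) < A%:R by rewrite ltr0n.
have bA : b < A%:R := truncnS_gt b.
have Ab : A%:R <= b + 1 by rewrite -natr1 lerD2r truncn_le.
pose G : finType := ('I_(4 * K * J).+1 * 'I_(2 * J * A * K).+1)%type.
have cardG : (#|G| * j ^ N < J ^ N)%N.
  rewrite -(ltr_nat R) !natrM !natrX; apply: le_lt_trans HN.
  rewrite ler_wpM2r ?exprn_ge0//.
  apply: (@le_trans _ _ (C%:R * A%:R)); last by rewrite ler_wpM2l.
  rewrite -natrM ler_nat card_prod !card_ord /C.
  by rewrite -[leqRHS]mulnA leq_mul2l /= /A; nia.
(* Rounding [x] costs at most [1/2] after scaling by [J], and rounding [t] as much since
   [a n <= b < A]. The floor in [u] costs at most 1 more, whence the enlarged cell of scaled length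
   2. *)
pose hx : R := (2 * J%:R)^-1.
pose ht : R := (2 * J%:R * A%:R)^-1.
have hx0 : 0 < hx by rewrite invr_gt0 !mulr_gt0.
have ht0 : 0 < ht by rewrite invr_gt0 !mulr_gt0.
pose gx (g : G) : R := - K%:R + hx * g.1%:R.
pose gt (g : G) : R := K%:R^-1 + ht * g.2%:R.
pose idx (i : 'I_N) := (s + K * i)%N.
pose y g i : R := gx g + gt g * a (idx i).
have gt_ge g : K%:R^-1 <= gt g by rewrite lerDl mulr_ge0// ltW.
have sR : s%:R = K%:R * (L%:R + K%:R) :> R by rewrite natrM natrD.
have yL g i : L%:R <= y g i.
  have gx_ge : - K%:R <= gx g by rewrite lerDl mulr_ge0// ltW.
  have sa : s%:R <= a (idx i).
    by rewrite (le_trans _ (class_A_ge _ _ _ aA))// ler_nat leq_addr.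
  have : K%:R^-1 * s%:R <= gt g * a (idx i).
    by rewrite ler_pM// ltW.
  rewrite sR mulKf ?gt_eqF ?ltr0n// /y; lra.
have y0 g i : 0 <= J%:R * y g i.
  by rewrite mulr_ge0// (le_trans _ (yL g i)).
pose u g i := Num.truncn (J%:R * y g i).
have uy g i : (u g i)%:R <= J%:R * y g i < (u g i)%:R + 1.
  by have := truncn_itv (y0 g i); rewrite natr1.
(* Quotient and remainder of the global cell number [u] by [J] are the unit interval and the cell in
   it. *)
pose m g i := (u g i %/ J)%N.
have um g i : u g i = (m g i * J + u g i %% J)%N := divn_eq _ _.
have m_lt g (i i' : 'I_N) : (i < i')%N -> (m g i < m g i')%N.
  move=> ii'; have : (u g i + J <= u g i')%N.
    rewrite truncn_ge_nat// natrD.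
    suff : y g i + 1 <= y g i'.
      move=> yy; apply: le_trans (ler_wpM2l (ltW JR) yy).
      by rewrite mulrDr mulr1 lerD2r; case/andP: (uy g i).
    rewrite /y -addrA lerD2l -lerBrDl -mulrBr.
    have aa : K%:R <= a (idx i') - a (idx i).
      have := class_A_gap _ _ (idx i) (idx i' - idx i)%N aA.
      have ? : (idx i + K <= idx i')%N by rewrite /idx; nia.
      rewrite subnKC; last by lia.
      have : K%:R <= (idx i' - idx i)%:R :> R by rewrite ler_nat; lia.
      lra.
    have : K%:R^-1 * K%:R <= gt g * (a (idx i') - a (idx i)).
      by rewrite ler_pM// ltW.
    by rewrite mulVf// gt_eqF ?ltr0n.
  have := ltn_pmod (u g i) (isT : 0 < J)%N.
  have := ltn_pmod (u g i') (isT : 0 < J)%N.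
  by have := um g i; have := um g i'; nia.
have m_inj g : injective (m g).
  move=> i i' mm; apply: val_inj.
  by case: (ltngtP i i') => // /(m_lt g); rewrite mm ltnn.
pose c g i : 'I_J := Ordinal (ltn_pmod (u g i) (isT : 0 < J)%N).
have [f Hf] := hitting_function G N j m c m_inj cardG.
pose M := (\max_g \max_i m g i).+1.
have mM g i : (m g i < M)%N.
  by rewrite ltnS (leq_trans (leq_bigmax i)) // (leq_bigmax g).
exists (maxn L M, f); split=> [|x t]; first exact: leq_maxl.
 rewrite ler_norml => /andP[xK1 xK2] Kt tK.
have [||i1 /andP[i1l i1r]] := floor_grid _ hx (x + K%:R) (4 * K * J)%N hx0.
- lra.
- rewrite !natrM (_ : hx * _ = K%:R + K%:R); first lra.
  by rewrite /hx; field; rewrite gt_eqF.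
have [||i2 /andP[i2l i2r]] := floor_grid _ ht (t - K%:R^-1) (2 * J * A * K)%N ht0.
- lra.
- rewrite !natrM (_ : ht * _ = K%:R); first lra.
  by rewrite /ht; field; rewrite !gt_eqF.
pose g : G := (i1, i2).
have [i fi] := Hf g; exists (idx i), (m g i); split.
  rewrite (leq_trans (mM g i) (leq_maxr _ _)) andbT.
  rewrite leq_divRL// truncn_ge_nat// natrM mulrC ler_pM2l//.
rewrite /= fi /= -um; have /andP[ul ur] := uy g i.
set z := a (idx i).
have z0 : 0 <= z by rewrite (le_trans _ (class_A_ge _ _ _ aA)).
have zb : z <= b.
  have iN := ltn_ord i.
  have := class_A_gap _ _ (idx i) (s + K * N - idx i)%N aA.
  rewrite subnKC; last by rewrite /idx leq_add2l leq_mul2l ltnW ?orbT.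
  by apply: le_trans; rewrite lerDl.
have xg : gx g <= x <= gx g + hx by rewrite /gx /=; apply/andP; split; lra.
have tg : gt g <= t <= gt g + ht by rewrite /gt /=; apply/andP; split; lra.
have htz : ht * z <= hx.
  have -> : hx = ht * A%:R by rewrite /hx /ht; field; rewrite !gt_eqF.
  by rewrite ler_pM2l//; lra.
have Jhx : J%:R * hx = 2^-1 by rewrite /hx; field; rewrite gt_eqF.
have /andP[tz1 tz2] : gt g * z <= t * z <= gt g * z + ht * z.
  by case/andP: tg => t1 t2; rewrite -mulrDl !ler_wpM2r.
have yl : J%:R * y g i <= J%:R * (x + t * z).
  by rewrite ler_pM2l// lerD//; case/andP: xg.
have yr : J%:R * (x + t * z) <= J%:R * (y g i + 2 * hx).
  by rewrite ler_pM2l// /y -/z; lra.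
have J2hx : J%:R * (y g i + 2 * hx) = J%:R * y g i + 1.
  by rewrite mulrDr mulrCA Jhx divff// pnatr_eq0.
rewrite J2hx in yr.
by rewrite -/J (le_trans ul yl) (le_trans yr)//; move: ur; lra.
Qed.

(** * Gluing the blocks *)

Lemma glue_blocks (T : Type) (v0 : T) (L : nat -> nat) (f : nat -> nat -> T) :
  {homo L : k k' / (k <= k')%N} ->
  exists g : nat -> T, forall k m, (L k <= m < L k.+1)%N -> g m = f k m.
Proof.
move=> L_homo; suff /choice[g Hg] : forall m, exists v, forall k,
    (L k <= m < L k.+1)%N -> v = f k m by exists g => k m; exact: Hg.
move=> m.
have [[k /andP[Lk kL]]|no] := pselect (exists k, (L k <= m < L k.+1)%N).
  exists (f k m) => k' /andP[Lk' k'L].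
  by have [/L_homo|/L_homo|->//] := ltngtP k k'; lia.
by exists v0 => k km; case: no; exists k.
Qed.

Lemma hit_all (R : realType) (a : nat -> R) (j : nat) :
  class_A a ->
  exists f : nat -> 'I_j.+1, forall x t : R, 0 < t -> exists n m,
    (m * j.+1 + f m)%:R <= j.+1%:R * (x + t * a n)
                        <= (m * j.+1 + f m)%:R + 2.
Proof.
move=> aA.
have [F HF] := choice (fun KL : nat * nat =>
  hit_compact _ _ j KL.1.+1 KL.2 aA isT).
(* Block [k] serves [K = k.+1] and starts where the previous one ends. *)
pose L := fix L k := if k is k'.+1 then (F (k', L k')).1 else 0%N.
have LS k : (L k <= L k.+1)%N by case: (HF (k, L k)).
have [f Hf] := glue_blocks _ ord0 L (fun k => (F (k, L k)).2)
  (homo_leq leqnn leq_trans LS).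
exists f => x t t0.
(* [k.+1] exceeds [|x|], [t] and [1/t] at once. *)
pose k := Num.truncn (`|x| + t + t^-1).
have tV0 : 0 < t^-1 by rewrite invr_gt0.
have kR : `|x| + t + t^-1 < k.+1%:R := truncnS_gt _.
have x0 := normr_ge0 x.
have [|||n [m [Lm nm]]] := (HF (k, L k)).2 x t.
- by apply/ltW; lra.
- by rewrite -[leRHS]invrK lef_pV2 ?posrE// ?ltr0n//; apply/ltW; lra.
- by apply/ltW; lra.
by exists n, m; rewrite (Hf k m Lm).
Qed.

(** * The set [E]: density and avoidance *)

Theorem theorem1p1 (R : realType) (a : nat -> R) (ha : class_A a)
    (p : R) (hp0 : 0 <= p) (hp1 : p < 1) :
  exists E : set R,
    [/\ lebesgue_measurable E,
        forall m : int,
          (p%:E <= completed_lebesgue_measure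
                     (E `&` `[m%:~R, (m%:~R + 1)%R]%classic))%E
      & forall x t : R, 0 < t -> ~ (affine_copy x t (range a) `<=` E)].
Proof.
pose j := Num.truncn (6 / (1 - p)).
have q0 : 0 < 1 - p by lra.
have JR : (0 : R) < j.+1%:R by rewrite ltr0n.
have Jp : 6 / j.+1%:R <= 1 - p.
  by rewrite ler_pdivrMr// mulrC -ler_pdivrMr// ltW// truncnS_gt.
have J6 : 6 / j.+1%:R <= 1 :> R by rewrite (le_trans Jp)// lerBlDr lerDl.
have [f Hf] := hit_all _ a j ha.
(* The choices [f] live on naturals; negative intervals simply reuse them through [|k|], as the hits
   all occur at nonnegative [m]. *)
pose l (k : int) : R := k%:~R + (f `|k|%N)%:R / j.+1%:R.
pose U k : set R := `[l k, l k + 2 / j.+1%:R]%classic.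
have l_itv k : k%:~R <= l k /\ l k <= k%:~R + 1.
  rewrite lerDl divr_ge0// lerD2l ler_pdivrMr// mul1r ler_nat ltnW//.
have muU k : completed_lebesgue_measure (U k) = (2 / j.+1%:R)%:E.
  have -> : completed_lebesgue_measure (U k) = lebesgue_measure (U k) by [].
  rewrite lebesgue_measure_itv /= lte_fin ltrDl divr_gt0// -EFinD.
  by congr EFin; ring.
exists (~` \bigcup_k U k); split.
- apply: sub_caratheodory; apply: measurableC.
  by apply: countable_bigcupT_measurable => // k; exact: measurable_itv.
- move=> m; set I := `[_, _]%classic; set E := ~` _.
  (* As [l k] lies in [[k, k + 1]] and [2 / j.+1 <= 1/3], only the cells of [m - 1], [m] and [m + 1]
     can meet [I]. Their total length is [6 / j.+1 <= 1 - p]. *)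
  have cover : I `<=` (E `&` I) `|` (U (m - 1) `|` (U m `|` U (m + 1))).
    move=> y; rewrite {1}/I /= in_itv /= => /andP[my ym].
    have [[k _ Uky]|nU] := pselect ((\bigcup_k U k) y); last first.
      by left; split => //; rewrite /I /= in_itv /= my ym.
    right; have /itvP yU : y \in `[l k, l k + 2 / j.+1%:R] by exact: Uky.
    have ly : l k <= y by rewrite yU.
    have yl : y <= l k + 2 / j.+1%:R by rewrite yU.
    have [lk1 lk2] := l_itv k.
    have km : (k <= m + 1)%R.
      by rewrite -(ler_int R) intrD; lra.
    have mk : (m - 2 < k)%R.
      rewrite -(ltr_int R) intrB; move: J6 yl; set r := _^-1 => J6 yl.
      lra.
    move: Uky; have [->|km1] := eqVneq k (m - 1); first by move=> ?; left.
    have [->|km0] := eqVneq k m; first by move=> ?; right; left.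
    have -> : k = m + 1 by lia.
    by move=> ?; right; right.
  have muI : completed_lebesgue_measure I = 1%:E.
    have -> : completed_lebesgue_measure I = lebesgue_measure I by [].
    rewrite lebesgue_measure_itv /= lte_fin ltrDl ltr01 -EFinD.
    by congr EFin; ring.
  have : (1%:E <= completed_lebesgue_measure (E `&` I)
                  + (2 / j.+1%:R + (2 / j.+1%:R + 2 / j.+1%:R))%:E)%E.
    have leU (A B : set R) : (completed_lebesgue_measure (A `|` B)
        <= completed_lebesgue_measure A + completed_lebesgue_measure B)%E.
      exact: outer_measureU2.
    rewrite -muI !EFinD -{1}(muU (m - 1)) -{1}(muU m) -(muU (m + 1)).
    have leI : (completed_lebesgue_measure I <= completed_lebesgue_measure
        ((E `&` I) `|` (U (m - 1)%R `|` (U m `|` U (m + 1)%R))))%E.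
      exact: le_outer_measure.
    apply: le_trans leI _; apply: le_trans (leU _ _) _; rewrite leeD2l//.
    by apply: le_trans (leU _ _) _; rewrite leeD2l.
  rewrite -leeBlDr// -EFinB; apply: le_trans; rewrite lee_fin.
  by move: Jp; set r := _^-1; lra.
- move=> x t t0 sub; have [n [m /andP[um mu]]] := Hf x t t0.
  have /sub : affine_copy x t (range a) (x + t * a n).
    by exists (a n) => //; exists n.
  apply; exists (m : int) => //; rewrite /U /= in_itv /=.
  have lm : l m * j.+1%:R = (m * j.+1 + f m)%:R.
    by rewrite /l mulrDl divfK ?gt_eqF// natrD natrM.
  have Jz : (x + t * a n) * j.+1%:R = j.+1%:R * (x + t * a n) := mulrC _ _.
  (* Multiplying both interval bounds by [j.+1] turns them into the inequalities of [hit_all]. *)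
  rewrite -(ler_pM2r JR) Jz lm um -(ler_pM2r JR) Jz.
  by rewrite [leRHS]mulrDl lm divfK ?gt_eqF.
Qed.
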